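(* Let $R$ be a commutative ring with identity, $A$ a commutative $R$-algebra with identity, $f$ an averaging operator on $A$, and $A_f=(A,[,]_f)$ the Lie algebra with bracket $[x,y]_f=xf(y)-yf(x)$. Then: (i) $A_f$ is solvable of length $2$, i.e. $A_f^{(2)}=0$. (ii) $A_f$ is nilpotent if and only if $f(A)^k\subseteq\{a\in A:aA_f^2=0\}$ for some $k>0$.
   Context: An averaging operator on $A$ is an $R$-module endomorphism $f:A\to A$ with $f(xf(y))=f(x)f(y)$ for all $x,y\in A$; then $[,]_f$ is a Lie bracket on the $R$-module $A$. For a Lie algebra $L$: $L^{(0)}=L$ and $L^{(k)}=[L^{(k-1)},L^{(k-1)}]$ for $k>0$; $L^1=L$ and $L^k=[L^{k-1},L]$ for $k>1$, where $[M,N]$ is the submodule spanned by the brackets $[m,n]$. In particular $A_f^2=[A,A]_f$. $L$ is nilpotent if $L^k=0$ for some $k>1$. $f(A)^k$ denotes the set of products (in the algebra $A$) of $k$ elements of $f(A)$. *)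

(* Defs.v *)
From HB Require Import structures.
From mathcomp Require Import all_boot all_algebra.
From mathcomp Require Import mathcomp_extra boolp classical_sets.

Set Implicit Arguments.
Unset Strict Implicit.
Unset Printing Implicit Defensive.

Import GRing.Theory.
Local Open Scope ring_scope.
Local Open Scope classical_set_scope.

(* A commutative R-algebra with identity is given by its structure morphism
   phi : R -> A.  Unlike comAlgType, which requires 1 != 0, this allows A = 0.
   alg_of phi is the ring A together with the R-module structure induced by
   phi; keying the instance on phi keeps it apart from other scalings on A. *)
Definition alg_of (R A : comPzRingType) (phi : {rmorphism R -> A}) : Type := A.

Section AlgOf.
Variables (R A : comPzRingType) (phi : {rmorphism R -> A}).

HB.instance Definition _ := GRing.ComPzRing.on (alg_of phi).

Definition alg_scale (a : R) (x : alg_of phi) : alg_of phi := phi a * x.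

Fact alg_scaleA a b x : alg_scale a (alg_scale b x) = alg_scale (a * b) x.
Proof. by rewrite /alg_scale rmorphM mulrA. Qed.

Fact alg_scale1 : left_id 1 alg_scale.
Proof. by move=> x; rewrite /alg_scale rmorph1 mul1r. Qed.

Fact alg_scaleDr : right_distributive alg_scale +%R.
Proof. by move=> a x y; rewrite /alg_scale mulrDr. Qed.

Fact alg_scaleDl x : {morph alg_scale^~ x : a b / a + b}.
Proof. by move=> a b; rewrite /alg_scale rmorphD mulrDl. Qed.

HB.instance Definition _ := GRing.Zmodule_isLmodule.Build R (alg_of phi)
  alg_scaleA alg_scale1 alg_scaleDr alg_scaleDl.

Lemma alg_scalerAl (a : R) (x y : alg_of phi) : a *: (x * y) = (a *: x) * y.
Proof. exact: mulrA. Qed.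

End AlgOf.

Record lieBracket (R : comPzRingType) (L : lmodType R) := LieBracket {
  lie_op :> L -> L -> L;
  lie_linearl : forall y, linear (lie_op^~ y);
  lie_linearr : forall x, linear (lie_op x);
  lie_alt : forall x, lie_op x x = 0;
  lie_jacobi : forall x y z,
    lie_op (lie_op x y) z + lie_op (lie_op y z) x + lie_op (lie_op z x) y = 0
}.

Section LieAlgebra.
Variables (R : comPzRingType) (L : lmodType R).

Definition lin_span (S : set L) : set L :=
  [set v | exists (n : nat) (c : 'I_n -> R) (s : 'I_n -> L),
     (forall i, S (s i)) /\ v = \sum_(i < n) c i *: s i].

Variable b : lieBracket L.

Definition lie_prod (M N : set L) : set L :=
  lin_span [set b m n | m in M & n in N].

(* L^(k) *)
Fixpoint derived_series (k : nat) : set L :=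
  if k is k'.+1 then lie_prod (derived_series k') (derived_series k')
  else [set: L].

(* L^k, indexed from L^1 = L; the value at k = 0 is a junk value. *)
Definition lower_central (k : nat) : set L :=
  iter k.-1 (fun M => lie_prod M [set: L]) [set: L].

Definition nilpotent_lie : Prop :=
  exists k : nat, (1 < k)%N /\ lower_central k = [set 0].

End LieAlgebra.

Section Averaging.
Variables (R A0 : comPzRingType) (phi : {rmorphism R -> A0}).
Local Notation A := (alg_of phi).

Definition averaging (f : A -> A) : Prop :=
  forall x y : A, f (x * f y) = f x * f y.

Variables (f : {linear A -> A}) (hf : averaging f).

Definition averaging_bracket (x y : A) : A := x * f y - y * f x.

Let scalerAr (a : R) (x y : A) : x * (a *: y) = a *: (x * y).
Proof. by rewrite mulrC -alg_scalerAl mulrC. Qed.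

Let f_bracket0 x y : f (averaging_bracket x y) = 0.
Proof. by rewrite raddfB /= !hf mulrC subrr. Qed.

Fact averaging_linearl y : linear (averaging_bracket^~ y).
Proof.
move=> a u v; rewrite /averaging_bracket linearP mulrDl mulrDr scalerAr.
by rewrite -alg_scalerAl scalerBr opprD addrACA.
Qed.

Fact averaging_alt x : averaging_bracket x x = 0.
Proof. exact: subrr. Qed.

Fact averaging_linearr x : linear (averaging_bracket x).
Proof.
have bN u v : averaging_bracket u v = - averaging_bracket v u.
  by rewrite /averaging_bracket opprB.
by move=> a u v; rewrite bN averaging_linearl opprD -scalerN -!bN.
Qed.

Fact averaging_jacobi x y z :
  averaging_bracket (averaging_bracket x y) z
  + averaging_bracket (averaging_bracket y z) x
  + averaging_bracket (averaging_bracket z x) y = 0.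
Proof.
have E u v w : averaging_bracket (averaging_bracket u v) w
             = u * f v * f w - v * f u * f w.
  by rewrite {1}/averaging_bracket f_bracket0 mulr0 subr0 mulrBl.
rewrite !E (mulrAC z (f y)) (mulrAC x (f z)) (mulrAC y (f x)).
by rewrite !subrKA subrr.
Qed.

Definition averaging_lie : lieBracket A :=
  LieBracket averaging_linearl averaging_linearr averaging_alt averaging_jacobi.

End Averaging.

(* All products of k elements of S, with no additive closure. *)
Definition power_set_prod (A : comPzRingType) (S : set A) (k : nat) : set A :=
  [set a | exists u : 'I_k -> A, (forall i, S (u i)) /\ a = \prod_(i < k) u i].

Definition annihilator (A : comPzRingType) (S : set A) : set A :=
  [set a | forall s, S s -> a * s = 0].

(* Main.v *)
Require Import Defs.
From mathcomp Require Import all_boot all_algebra.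
From mathcomp Require Import classical_sets.

(* An averaging operator f kills every bracket, so [z, y]_f = z f(y) whenever
   z lies in A_f^2.  Hence brackets of elements of A_f^2 vanish, and each step
   down the lower central series trades one factor from f(A): f(A)^(i+1)
   annihilates A_f^(j+2) iff f(A)^i annihilates A_f^(j+3).  Iterating, f(A)^k
   annihilates A_f^2 iff f(A)^0 = {1} annihilates A_f^(k+2). *)

Set Implicit Arguments.
Unset Strict Implicit.
Unset Printing Implicit Defensive.

Import GRing.Theory.
Local Open Scope ring_scope.
Local Open Scope classical_set_scope.

Section LieSpans.
Variables (R : comPzRingType) (L : lmodType R).

Lemma lin_span0 (S : set L) : lin_span S 0.
Proof.
by exists 0%N, (fun=> 0), (fun=> 0); split=> [[]|]; rewrite ?big_ord0.
Qed.

Lemma sub_lin_span (S : set L) : S `<=` lin_span S.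
Proof.
move=> x Sx; exists 1%N, (fun=> 1), (fun=> x); split=> //.
by rewrite big_ord1 scale1r.
Qed.

Lemma lin_span_ker (V : lmodType R) (g : {linear L -> V}) (S : set L) :
  (forall x, S x -> g x = 0) -> forall x, lin_span S x -> g x = 0.
Proof.
move=> gS x [n [c [s [Ss ->]]]]; rewrite linear_sum big1 // => i _.
by rewrite linearZ_LR gS // scaler0.
Qed.

Variable b : lieBracket L.

Lemma lie_prod_eq0 (M N : set L) :
  (forall m n, M m -> N n -> b m n = 0) -> lie_prod b M N = [set 0].
Proof.
move=> bMN0; apply/seteqP; split=> x; last by move=> ->; exact: lin_span0.
by apply: (@lin_span_ker L idfun) => _ [m Mm [n Nn <-]]; exact: bMN0.
Qed.

Lemma lie_prodl0 (N : set L) : lie_prod b [set 0] N = [set 0].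
Proof.
apply: lie_prod_eq0 => _ n -> _.
(* [linear] is a single identity in one scalar and two vectors; at -1, 0, 0 it reads
   [b 0 n = - b 0 n + b 0 n]. *)
by have := lie_linearl b n (-1) 0 0; rewrite /= scaler0 addr0 scaleN1r addNr.
Qed.

Lemma lower_central0 j : lower_central b j 0.
Proof. by case: j => [|[|j]] //; exact: lin_span0. Qed.

End LieSpans.

Lemma power_set_prodS (A : comPzRingType) (S : set A) (k : nat) (a : A) :
  power_set_prod S k.+1 a <->
  exists2 p, power_set_prod S k p & exists2 u, S u & a = u * p.
Proof.
split=> [[u [Su ->]]|[_ [v [Sv ->]] [u Su ->]]].
  exists (\prod_(i < k) u (lift ord0 i)).
    by exists (fun i => u (lift ord0 i)).
  by exists (u ord0) => //; rewrite big_ord_recl.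
(* The new family takes the value [u] at [ord0] and continues with [v]. *)
exists (fun i => if unlift ord0 i is Some j then v j else u); split=> [i|].
  by case: unliftP.
rewrite big_ord_recl unlift_none; congr (_ * _).
by apply: eq_bigr => i _; rewrite liftK.
Qed.

Section AveragingLie.
Variables (R A : comPzRingType) (phi : {rmorphism R -> A}).
Variables (f : {linear alg_of phi -> alg_of phi}) (hf : averaging f).
Local Notation b := (averaging_lie hf).
Local Notation ann j := (annihilator (lower_central b j)).
Local Notation fpow := (power_set_prod (range f)).

(** By averaging and commutativity, [f] sends both terms of the bracket to [f x * f y], so they
    cancel. *)
Lemma averaging_lie_ker x y : f (b x y) = 0.
Proof. by rewrite raddfB /= !hf mulrC subrr. Qed.

Lemma lie_prod_averaging_ker (M N : set (alg_of phi)) z :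
  lie_prod b M N z -> f z = 0.
Proof.
by apply: lin_span_ker => _ [m _ [n _ <-]]; exact: averaging_lie_ker.
Qed.

Lemma averaging_lie_kerl z y : f z = 0 -> b z y = z * f y.
Proof. by move=> fz0; rewrite /= /averaging_bracket fz0 mulr0 subr0. Qed.

Lemma mul_lin_span_eq0 (p : alg_of phi) (S : set (alg_of phi)) :
  (forall x, S x -> p * x = 0) -> forall x, lin_span S x -> p * x = 0.
Proof.
move=> pS x [n [c [s [Ss ->]]]]; rewrite mulr_sumr big1 // => i _.
by rewrite mulrC -alg_scalerAl mulrC pS // scaler0.
Qed.

(** For [z] in the term of index [j.+2], [f y * p * z = p * (z * f y) = p * b z y], and these
    brackets [b z y] span the next term. The index starts at 2 because from there on a term is a
    span of brackets, hence killed by [f]. *)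
Lemma fpow_ann_shift i j :
  fpow i.+1 `<=` ann j.+2 <-> fpow i `<=` ann j.+3.
Proof.
split=> [ann_i p pi z|ann_i _ /power_set_prodS[p pi [_ [y _ <-] ->]] z jz].
  apply: mul_lin_span_eq0 => _ [m jm [y _ <-]].
  rewrite averaging_lie_kerl; last exact: lie_prod_averaging_ker jm.
  rewrite mulrA mulrC mulrA; apply: ann_i jm.
  by apply/power_set_prodS; exists p => //; exists (f y).
rewrite -mulrA mulrCA (mulrC (f y)) -averaging_lie_kerl.
  by apply: ann_i => //; apply: sub_lin_span; exists z => //; exists y.
exact: lie_prod_averaging_ker jz.
Qed.

(** [j] stays general because each step of the induction on [k] raises it by one. *)
Lemma fpow_ann_lower_central k j :
  fpow k `<=` ann j.+2 <-> lower_central b (k + j).+2 = [set 0].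
Proof.
elim: k j => [|k IHk] j; last by rewrite fpow_ann_shift IHk addnS.
split=> [ann1|-> p _ _ ->]; last exact: mulr0.
apply/seteqP; split=> z; last by move=> ->; exact: lower_central0.
move=> jz; rewrite /= -[z]mul1r; apply: ann1 jz.
(* The empty product puts 1 in [fpow 0]; any function on the empty type ['I_0] is a witness. *)
by exists (fun=> 0); split=> [[]|]; rewrite ?big_ord0.
Qed.

End AveragingLie.

Theorem proposition5p3 (R A : comPzRingType) (phi : {rmorphism R -> A})
    (f : {linear alg_of phi -> alg_of phi}) (hf : averaging f) :
  derived_series (averaging_lie hf) 2 = [set 0]
  /\ (nilpotent_lie (averaging_lie hf) <->
      exists k : nat, (0 < k)%N /\
        power_set_prod (range f) k
          `<=` annihilator (lower_central (averaging_lie hf) 2)).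
Proof.
split.
  apply: lie_prod_eq0 => m n /lie_prod_averaging_ker fm0.
  move=> /lie_prod_averaging_ker fn0.
  by rewrite averaging_lie_kerl // fn0 mulr0.
split=> [[[|k] [//= k_gt0 Lk0]]|[k [k_gt0 /fpow_ann_lower_central Lk0]]].
  (* Here the term of index [k.+1] vanishes, while exponent [k] asks this of index [k.+2], one step
     further down. Exponent [k.-1] would match exactly, but it is 0 when [k = 1]. *)
  exists k; split=> //; apply/fpow_ann_lower_central; rewrite addn0.
  case: k k_gt0 Lk0 => // k _ Lk0.
  by rewrite -[LHS]/(lie_prod _ (lower_central _ k.+2) _) Lk0 lie_prodl0.
by exists (k + 0).+2.
Qed.
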